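(* Suppose $\nu_0<\nu_1$. Consider testing $H_0:\boldsymbol\theta=\mathbf 0$ versus $H_1:\boldsymbol\theta\neq\mathbf 0$ where, under $H_1$, $\boldsymbol\theta\mid g,\boldsymbol\gamma_1,\sigma_1^2\sim N_{r_1}(\mathbf 0,g\sigma_1^2\boldsymbol\Omega)$, $\pi_1(\boldsymbol\gamma_1)\propto1$, $\sigma_1^2\sim\text{inv-}\chi^2(s_1^2,\nu_1)$, and $g$ has a prior with density $\pi(g)$ on $(0,\infty)$; and, under $H_0$, $\pi_0(\boldsymbol\gamma_0)\propto1$ and $\sigma_0^2\sim\text{inv-}\chi^2(s_0^2,\nu_0)$. Let $B_{10}$ be the resulting Bayes factor. Then: 1. If there exist $0<M<\infty$, $0<K<\infty$ and $\alpha>1$ such that $\pi(g)\ge Kg^{-\alpha}$ for all $g\ge M$, then $B_{10}$ is information consistent whenever $\alpha<(n-r_1-r_2+\nu_0)/2+1$. 2. If there exist $0<M'<\infty$, $0<K'<\infty$ and $\alpha>1$ such that $\pi(g)\le K'g^{-\alpha}$ for all $g\ge M'$, then $B_{10}$ is information inconsistent whenever $\alpha\ge(n-r_1-r_2+\nu_0)/2+1$.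
   Context: Model: $\mathbf y=\mathbf X_{\boldsymbol\theta}\boldsymbol\theta+\mathbf X_{\boldsymbol\gamma}\boldsymbol\gamma+\boldsymbol\epsilon$, $\boldsymbol\epsilon\sim N(\mathbf 0,\sigma^2\boldsymbol\Sigma)$, with $\mathbf y\in\mathbb R^n$, $\boldsymbol\theta\in\mathbb R^{r_1}$ ($r_1\ge1$) the tested parameters, $\boldsymbol\gamma\in\mathbb R^{r_2}$ ($r_2\ge0$) nuisance parameters, $n>r_1+r_2$, $\boldsymbol\Sigma$ a known positive definite matrix, $[\mathbf X_{\boldsymbol\theta}\ \mathbf X_{\boldsymbol\gamma}]$ of full column rank, and $\mathbf X_{\boldsymbol\theta}'\boldsymbol\Sigma^{-1}\mathbf X_{\boldsymbol\gamma}=\mathbf 0$. Let $\mathcal I=\mathbf X_{\boldsymbol\theta}'\boldsymbol\Sigma^{-1}\mathbf X_{\boldsymbol\theta}$, $\hat{\boldsymbol\theta}=\mathcal I^{-1}\mathbf X_{\boldsymbol\theta}'\boldsymbol\Sigma^{-1}\mathbf y$ (the ML estimate), and let $s_{\mathbf y}^2=(\mathbf y-\mathbf X_{\boldsymbol\theta}\hat{\boldsymbol\theta}-\mathbf X_{\boldsymbol\gamma}\hat{\boldsymbol\gamma})'\boldsymbol\Sigma^{-1}(\mathbf y-\mathbf X_{\boldsymbol\theta}\hat{\boldsymbol\theta}-\mathbf X_{\boldsymbol\gamma}\hat{\boldsymbol\gamma})$. $\boldsymbol\Omega$ is a fixed positive definite $r_1\times r_1$ matrix, $\nu_t\ge 0$,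 $s_t>0$; $\text{inv-}\chi^2(s^2,\nu)$ has density proportional to $(\sigma^2)^{-\nu/2-1}e^{-\nu s^2/(2\sigma^2)}$, with $\nu=0$ denoting the improper prior $\sigma^{-2}$. $\pi(g)$ is a probability density on $(0,\infty)$. The Bayes factor (ratio of marginal likelihoods) is $B_{10}=\int_0^\infty B_{10}(g)\pi(g)\,dg$, where $$B_{10}(g)=C_1(g)\frac{\left(s_1^2\nu_1+s_{\mathbf y}^2+\hat{\boldsymbol\theta}'(\mathcal I^{-1}+g\boldsymbol\Omega)^{-1}\hat{\boldsymbol\theta}\right)^{-(n+\nu_1-r_2)/2}}{\left(s_0^2\nu_0+s_{\mathbf y}^2+\hat{\boldsymbol\theta}'\mathcal I\hat{\boldsymbol\theta}\right)^{-(n+\nu_0-r_2)/2}},\qquad C_1(g)=\frac{\kappa_1\Gamma(\frac{n+\nu_1-r_2}{2})}{\kappa_0\Gamma(\frac{n+\nu_0-r_2}{2})}2^{(\nu_1-\nu_0)/2}|g\boldsymbol\Omega+\mathcal I^{-1}|^{-1/2}|\mathcal I|^{-1/2},$$ with $\kappa_t=(\nu_t/2)^{\nu_t/2}s_t^{\nu_t}/\Gamma(\nu_t/2)$ if $\nu_t>0$ and $\kappa_t=1$ if $\nu_t=0$. Definition: $B_{10}$ is information inconsistent if there exists a sequence of possible data with corresponding $|\hat{\boldsymbol\theta}_i|\to\infty$ as $i\to\infty$ along which $B_{10}<B_{10}^*$ for some constant $B_{10}^*<\infty$; otherwise (i.e. $B_{10}\to\infty$ whenever $|\hat{\boldsymbol\theta}|\to\infty$)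 it is information consistent. All other quantities ($n$, design, $\boldsymbol\Sigma$, hyperparameters, $s_{\mathbf y}^2>0$) are held fixed along the sequence. *)

(* Defs.v *)
From HB Require Import structures.
From mathcomp Require Import all_boot all_order all_algebra.
From mathcomp Require Import all_classical all_reals all_analysis.

Set Implicit Arguments.
Unset Strict Implicit.
Unset Printing Implicit Defensive.

Import Order.TTheory GRing.Theory Num.Theory.
Import numFieldNormedType.Exports.
Local Open Scope classical_set_scope.
Local Open Scope ring_scope.

Definition qform (R : realType) (k : nat) (A : 'M[R]_k) (v : 'cV[R]_k) : R :=
  (v^T *m A *m v) 0 0.

(* The library norm on matrices is the sup norm, hence an explicit Euclidean
   one. *)
Definition enorm (R : realType) (k : nat) (v : 'cV[R]_k) : R :=
  Num.sqrt (\sum_(i < k) v i 0 ^+ 2).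

Definition posdefmx (R : realType) (k : nat) (A : 'M[R]_k) : Prop :=
  A^T = A /\ forall v : 'cV[R]_k, v != 0 -> 0 < qform A v.

(* Euler's Gamma function, meaningful for x > 0. *)
Definition Gamma (R : realType) (x : R) : R :=
  \int[lebesgue_measure]_(t in `]0%R, +oo[) (t `^ (x - 1) * expR (- t)).

Definition density_pos (R : realType) (p : R -> R) : Prop :=
  [/\ measurable_fun (`]0%R, +oo[ : set R) p,
      forall g, 0 < g -> 0 <= p g &
      (\int[lebesgue_measure]_(g in `]0%R, +oo[) (p g)%:E = 1)%E].

(* [info X Sigma] and [gls X Sigma y] are the information matrix
   X' Sigma^-1 X and the generalized least squares estimate.  When
   Xt' Sigma^-1 Xg = 0, the joint maximum likelihood estimate in the model
   y = Xt theta + Xg gamma + eps, eps ~ N(0, sigma^2 Sigma), is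
   (gls Xt Sigma y, gls Xg Sigma y). *)
Definition info (R : realType) (n r : nat) (X : 'M[R]_(n, r)) (Sigma : 'M[R]_n) :
    'M[R]_r :=
  X^T *m invmx Sigma *m X.

Definition gls (R : realType) (n r : nat) (X : 'M[R]_(n, r)) (Sigma : 'M[R]_n)
    (y : 'cV[R]_n) : 'cV[R]_r :=
  invmx (info X Sigma) *m (X^T *m invmx Sigma *m y).

Definition resid_ss (R : realType) (n r1 r2 : nat) (Xt : 'M[R]_(n, r1))
    (Xg : 'M[R]_(n, r2)) (Sigma : 'M[R]_n) (y : 'cV[R]_n) : R :=
  qform (invmx Sigma) (y - Xt *m gls Xt Sigma y - Xg *m gls Xg Sigma y).

(* Normalizing constant of the prior on sigma^2 with density proportional to
   (sigma^2)^(-nu/2-1) exp(-nu s^2 / (2 sigma^2)); the improper prior sigma^-2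
   (nu = 0) gets the constant 1. *)
Definition kappa (R : realType) (nu s : R) : R :=
  if 0 < nu then (nu / 2) `^ (nu / 2) * s `^ nu / Gamma (nu / 2) else 1.

Definition half_df (R : realType) (n r2 : nat) (nu : R) : R :=
  (n%:R + nu - r2%:R) / 2.

Definition C1 (R : realType) (n r1 r2 : nat) (Xt : 'M[R]_(n, r1))
    (Sigma : 'M[R]_n) (Omega : 'M[R]_r1) (nu0 s0 nu1 s1 g : R) : R :=
  (kappa nu1 s1 * Gamma (half_df n r2 nu1)) /
  (kappa nu0 s0 * Gamma (half_df n r2 nu0)) *
  2 `^ ((nu1 - nu0) / 2) *
  \det (g *: Omega + invmx (info Xt Sigma)) `^ (- 2^-1) *
  \det (info Xt Sigma) `^ (- 2^-1).

(* Ratio m1(y | g) / m0(y) of the marginal likelihoods obtained from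
   - H1: theta | g, gamma1, sigma1^2 ~ N(0, g sigma1^2 Omega), flat prior on
     gamma1, sigma1^2 ~ inv-chi^2(s1^2, nu1);
   - H0: theta = 0, flat prior on gamma0, sigma0^2 ~ inv-chi^2(s0^2, nu0)
   after integrating theta, gamma and sigma^2 out analytically. *)
Definition BF_given (R : realType) (n r1 r2 : nat) (Xt : 'M[R]_(n, r1))
    (Xg : 'M[R]_(n, r2)) (Sigma : 'M[R]_n) (Omega : 'M[R]_r1)
    (nu0 s0 nu1 s1 : R) (y : 'cV[R]_n) (g : R) : R :=
  let thetahat := gls Xt Sigma y in
  let I := info Xt Sigma in
  let s2y := resid_ss Xt Xg Sigma y in
  C1 r2 Xt Sigma Omega nu0 s0 nu1 s1 g *
  ((s1 ^+ 2 * nu1 + s2y + qform (invmx (invmx I + g *: Omega)) thetahat)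
     `^ (- half_df n r2 nu1) /
   (s0 ^+ 2 * nu0 + s2y + qform I thetahat) `^ (- half_df n r2 nu0)).

Definition BF (R : realType) (n r1 r2 : nat) (Xt : 'M[R]_(n, r1))
    (Xg : 'M[R]_(n, r2)) (Sigma : 'M[R]_n) (Omega : 'M[R]_r1)
    (nu0 s0 nu1 s1 : R) (p : R -> R) (y : 'cV[R]_n) : \bar R :=
  (\int[lebesgue_measure]_(g in `]0%R, +oo[)
     (BF_given Xt Xg Sigma Omega nu0 s0 nu1 s1 y g * p g)%:E)%E.

(* A sequence of data along which the ML estimate of theta diverges while the
   residual sum of squares keeps the fixed value s2. *)
Definition diverging_data (R : realType) (n r1 r2 : nat) (Xt : 'M[R]_(n, r1))
    (Xg : 'M[R]_(n, r2)) (Sigma : 'M[R]_n) (s2 : R) (y : nat -> 'cV[R]_n) : Prop :=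
  (forall i, resid_ss Xt Xg Sigma (y i) = s2) /\
  enorm (gls Xt Sigma (y i)) @[i --> \oo] --> +oo.

Definition info_inconsistent (R : realType) (n r1 r2 : nat) (Xt : 'M[R]_(n, r1))
    (Xg : 'M[R]_(n, r2)) (Sigma : 'M[R]_n) (s2 : R) (B : 'cV[R]_n -> \bar R) :
    Prop :=
  exists2 y : nat -> 'cV[R]_n, diverging_data Xt Xg Sigma s2 y &
    exists Bstar : R, forall i, (B (y i) < Bstar%:E)%E.

Definition info_consistent (R : realType) (n r1 r2 : nat) (Xt : 'M[R]_(n, r1))
    (Xg : 'M[R]_(n, r2)) (Sigma : 'M[R]_n) (s2 : R) (B : 'cV[R]_n -> \bar R) :
    Prop :=
  ~ info_inconsistent Xt Xg Sigma s2 B.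

Lemma info_consistentP (R : realType) (n r1 r2 : nat) (Xt : 'M[R]_(n, r1))
    (Xg : 'M[R]_(n, r2)) (Sigma : 'M[R]_n) (s2 : R) (B : 'cV[R]_n -> \bar R) :
  info_consistent Xt Xg Sigma s2 B <->
  forall y, diverging_data Xt Xg Sigma s2 y -> B (y i) @[i --> \oo] --> +oo%E.
Proof.
split=> [cons y [ys yoo]|cons [y ydiv [b yb]]].
  apply/cvgeyPge => A; apply: contrapT => nA; apply: cons.
  have /choice[f fP] : forall N, exists i, (N <= i)%N /\ (B (y i) < A%:E)%E.
    move=> N; apply: contrapT => nN; apply: nA; exists N => // i /= Ni.
    by rewrite leNgt; apply/negP => iA; apply: nN; exists i.
  exists (y \o f); last by exists A => i; case: (fP i).
  split=> [i|]; first exact: ys.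
  apply/cvgryPge => M; move/cvgryPge : yoo => /(_ M)[N _ NM].
  exists N => // i /= Ni; apply: NM => /=.
  by case: (fP i) => [if_ _]; exact: leq_trans Ni if_.
have /cvgeyPge/(_ b)[N _ /(_ N (leqnn N))] := cons y ydiv.
by move=> /= bN; have := yb N; rewrite ltNge bN.
Qed.

(* Main.v *)
Require Import Defs.
From HB Require Import structures.
From mathcomp Require Import all_boot all_order all_algebra.
From mathcomp Require Import all_classical all_reals all_analysis.
From mathcomp Require Import measurable_realfun ring lra.

Import Order.TTheory GRing.Theory Num.Theory.
Import numFieldNormedType.Exports.
Local Open Scope classical_set_scope.
Local Open Scope ring_scope.

(** Write T for |thetahat|^2 along a sequence of data whose residual sum of
squares stays equal to s2, and put a_t = (n + nu_t - r2) / 2, r = r1.  The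
conditional Bayes factor is, up to a positive constant,
  det (I^-1 + g Omega)^(-1/2) * (c1 + Q(g))^(-a1) * (c0 + thetahat' I thetahat)^(a0),
where Q(g) = thetahat' (I^-1 + g Omega)^-1 thetahat.  Linear algebra shows that,
uniformly in g > 0, the determinant is of exact order (1 + g)^r, that Q(g) is at
most of order T / g and, for thetahat on a fixed line, at least of order
T / (1 + g), and that thetahat' I thetahat is of order T
([det_pencil_bounds], [qform_inv_pencil_le], [qform_inv_pencil_ge],
[posdef_sqnorm_le]).  So only the values of g of order T matter: there Q(g) is
bounded and the conditional Bayes factor is of order T^(a0 - r/2).

If pi(g) >= K g^(-alpha) for large g, the interval [T, 2T] alone contributes at
least a constant times
  T * T^(a0 - r/2) * T^(-alpha) = T^(a0 - r/2 - alpha + 1),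
which diverges when alpha < a0 - r/2 + 1 = (n - r1 - r2 + nu0) / 2 + 1.

If pi(g) <= K' g^(-alpha) for large g and alpha >= a0 - r/2 + 1, let the estimate
run along a fixed line, with a fixed residual vector.  Values g <= M' contribute
at most a constant times T^(a0 - a1), bounded because nu0 < nu1.  For g >= M' and
u = T / g the integrand is at most a constant times
g^-1 u^(a0) (1 + u)^(-a1), and this is dominated by a log-logistic density in g
with scale T and shape d = min (a0, a1 - a0), up to a constant factor
([le_loglogistic]).  Its integral is bounded independently of T
([integral_loglogistic_le]), so the Bayes factor stays
bounded.  That a1 > a0 makes d positive is where the hypothesis nu0 < nu1 is
decisive: u^(a0) (1 + u)^(-a1) then decays as g / T tends to 0 as well as when it
tends to infinity. *)

(** * Integrals of nonnegative functions *)

(** The integral of a nonnegative function is a supremum over the simple functions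
below it, so it is monotone even for functions that are not known to be
measurable.  It is applied to the Bayes factor as a function of [g]. *)
Lemma le_integral_nonneg d (T : measurableType d) (R : realType)
    (mu : {measure set T -> \bar R}) (D : set T) (f g : T -> \bar R) :
  (forall x, D x -> 0 <= f x)%E -> (forall x, D x -> f x <= g x)%E ->
  (\int[mu]_(x in D) f x <= \int[mu]_(x in D) g x)%E.
Proof.
move=> f0 fg.
have g0 x : D x -> (0 <= g x)%E by move=> Dx; exact: le_trans (f0 _ Dx) (fg _ Dx).
rewrite !ge0_integralE//; apply: le_ereal_sup => _ [h hf <-]; exists h => //= x.
apply: le_trans (hf x) _; exact: lee_restrict.
Qed.

Lemma integral_ge_cst d (T : measurableType d) (R : realType)
    (mu : {measure set T -> \bar R}) (A D : set T) (f : T -> \bar R) (c : R) :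
  measurable A -> A `<=` D -> 0 <= c ->
  (forall x, D x -> 0 <= f x)%E -> (forall x, A x -> c%:E <= f x)%E ->
  (c%:E * mu A <= \int[mu]_(x in D) f x)%E.
Proof.
move=> mA AD c0 f0 cf; rewrite -integral_cst//.
have -> : A = D `&` A by rewrite setIC; apply/esym/setIidPl.
rewrite integral_mkcondr; apply: le_integral_nonneg => x Dx.
  by apply: erestrict_ge0 => y _; rewrite lee_fin.
by rewrite /patch; case: ifPn => [|_]; [rewrite inE => /cf|exact: f0].
Qed.

(** The fundamental theorem of calculus on the compact intervals [1/n, n], followed
by monotone convergence.  Since [F] only enters through its oscillation, this
covers integrands that are singular at 0. *)
Lemma integral_derive_le (R : realType) (f F : R -> R) (c : R) :
  (forall x : R, 0 < x -> is_derive x 1 F (f x)) ->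
  (forall x : R, 0 < x -> 0 <= f x) ->
  (forall x : R, 0 < x -> {for x, continuous f}) ->
  (forall x y : R, 0 < x -> 0 < y -> F y - F x <= c) ->
  (\int[lebesgue_measure]_(x in `]0%R, +oo[) (f x)%:E <= c%:E)%E.
Proof.
move=> dF f0 cf Fc.
pose E (n : nat) : set R := `[n.+2%:R^-1, n.+2%:R]%classic.
have Egt0 n x : E n x -> 0 < x.
  by rewrite /E/= in_itv/= => /andP[+ _]; apply: lt_le_trans; rewrite invr_gt0.
have EE : `]0%R, +oo[%classic = \bigcup_n E n.
  apply/seteqP; split=> [x|x [n _ /Egt0]]; last by rewrite /= in_itv/= andbT.
  rewrite /= in_itv/= andbT => x0.
  pose n := maxn (Num.bound x) (Num.bound x^-1).
  exists n => //; rewrite /E/= in_itv/=; apply/andP; split.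
    rewrite invf_ple ?posrE// ltW//.
    apply: lt_le_trans (archi_boundP _) _; first by rewrite invr_ge0 ltW.
    by rewrite ler_nat ltnW// ltnS ltnW// ltnS leq_maxr.
  apply/ltW/(lt_le_trans (archi_boundP (ltW x0))).
  by rewrite ler_nat ltnW// ltnS ltnW// ltnS leq_maxl.
have contF (x : R) : 0 < x -> {for x, continuous F}.
  by move=> /dF[df _]; apply/differentiable_continuous/derivable1_diffP.
rewrite EE; apply: cvge_le; last first.
- apply: ge0_nondecreasing_set_cvg_integral => [|n|n|n x].
  + move=> m n mn; apply/subsetPset => x; rewrite /E/= !in_itv/= => /andP[ax xb].
    rewrite (le_trans _ ax) ?(le_trans xb) ?ler_nat ?ltnS//.
    by rewrite lef_pV2 ?posrE ?ltr0n// ler_nat !ltnS.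
  + exact: measurable_itv.
  + apply/measurable_EFinP; apply: subspace_continuous_measurable_fun.
      exact: measurable_itv.
    apply: continuous_in_subspaceT => x; rewrite inE => /Egt0; exact: cf.
  + by move=> /Egt0 /f0; rewrite lee_fin.
- apply: nearW => n.
  have n0 : 0 < n.+2%:R^-1 :> R by rewrite invr_gt0.
  rewrite (@continuous_FTC2 _ f F).
  + by rewrite -EFinB lee_fin; exact: Fc.
  + by rewrite invf_plt ?posrE// (@lt_trans _ _ 1) ?invf_lt1 ?ltr1n.
  + apply: continuous_in_subspaceT => x; rewrite inE => /Egt0; exact: cf.
  + split.
    * move=> x; rewrite in_itv/= => /andP[ax _].
      by case: (dF x (lt_trans n0 ax)).
    * by apply: cvg_at_right_filter; exact: contF.
    * by apply: cvg_at_left_filter; exact: contF.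
  + move=> x; rewrite in_itv/= => /andP[ax _].
    by rewrite derive1E; case: (dF x (lt_trans n0 ax)).
- exact: eventually_filter.
Qed.

(** * The log-logistic kernel and Euler's integral *)

Section kernel.
Context {R : realType}.
Implicit Types T d g : R.

(** [d * loglogistic T d] is the density of the log-logistic distribution with
scale [T] and shape [d].  It serves as the dominating function of the file, because
it behaves as a power of [g] on each side of [T] and has an explicit primitive. *)
Definition loglogistic T d g : R := T `^ d * g `^ (d - 1) / (T `^ d + g `^ d) ^+ 2.

Let loglogistic_prim T d g : R := - (T `^ d / (T `^ d + g `^ d)).

Lemma loglogistic_ge0 T d g : 0 <= loglogistic T d g.
Proof. by rewrite /loglogistic divr_ge0 ?sqr_ge0 ?mulr_ge0 ?powR_ge0. Qed.

Let is_derive_loglogistic_prim T d g : 0 < T -> 0 < g ->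
  is_derive g 1 (loglogistic_prim T d) (d * loglogistic T d g).
Proof.
move=> T0 g0.
have P0 : 0 < T `^ d by exact: powR_gt0.
have Q0 : T `^ d + g `^ d != 0 by rewrite gt_eqF ?addr_gt0 ?powR_gt0.
have H1 : is_derive g 1 (cst (T `^ d) + (fun x : R => x `^ d)) (d * g `^ (d - 1)).
  rewrite -[X in is_derive _ _ _ X]add0r; apply: is_deriveD; exact: is_derive1_powR.
have H2 := @is_deriveV _ (fun x : R => T `^ d + x `^ d) g _ 1 Q0 H1.
have H3 : is_derive g 1 (- (T `^ d *: (fun x : R => (T `^ d + x `^ d)^-1)))
    (- (T `^ d *: (- (T `^ d + g `^ d) ^- 2 *: (d * g `^ (d - 1))))).
  by apply: is_deriveN; apply: is_deriveZ.
rewrite (_ : d * loglogistic T d g =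
    - (T `^ d *: (- (T `^ d + g `^ d) ^- 2 *: (d * g `^ (d - 1))))).
  exact: H3.
rewrite /loglogistic /GRing.scale /=.
by field.
Qed.

Let continuous_powR a g : 0 < g -> {for g, continuous (fun x : R => x `^ a)}.
Proof.
move=> g0; have [df _] := @is_derive1_powR R a g g0.
by apply/differentiable_continuous/derivable1_diffP.
Qed.

Lemma continuous_loglogistic T d g : 0 < T -> 0 < g -> {for g, continuous (loglogistic T d)}.
Proof.
move=> T0 g0; rewrite /loglogistic.
apply: cvgM; first by apply: cvgM; [exact: cvg_cst|exact: continuous_powR].
apply: cvgV; first by rewrite expf_eq0/= gt_eqF ?addr_gt0 ?powR_gt0.
have cD : {for g, continuous (fun x : R => T `^ d + x `^ d)}.
  by apply: cvgD; [exact: cvg_cst|exact: continuous_powR].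
exact: (cvgM cD cD).
Qed.

Lemma measurable_loglogistic T d : 0 < T ->
  measurable_fun (`]0%R, +oo[ : set R) (loglogistic T d).
Proof.
move=> T0; apply: open_continuous_measurable_fun; first exact: interval_open.
by move=> g; rewrite inE/= in_itv/= andbT; exact: continuous_loglogistic.
Qed.

Lemma integral_loglogistic_le T d : 0 < T -> 0 < d ->
  (\int[lebesgue_measure]_(g in `]0%R, +oo[) (loglogistic T d g)%:E <= (d^-1)%:E)%E.
Proof.
move=> T0 d0; apply: (@integral_derive_le R (loglogistic T d)
  (d^-1 *: (loglogistic_prim T d : R -> R)) d^-1).
- move=> g g0; rewrite -[loglogistic T d g](mulKf (lt0r_neq0 d0)).
  by apply: is_deriveZ; exact: is_derive_loglogistic_prim.
- by move=> g _; exact: loglogistic_ge0.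
- by move=> g; exact: continuous_loglogistic.
- move=> x y x0 y0; rewrite /= -mulrBr ler_piMr ?invr_ge0 ?ltW//.
  have F0 : 0 <= T `^ d / (T `^ d + y `^ d) by rewrite divr_ge0 ?addr_ge0 ?powR_ge0.
  rewrite /loglogistic_prim opprK addrC ltrBlDr; apply: ltr_wpDr => //.
  by rewrite ltr_pdivrMr ?addr_gt0 ?powR_gt0// mul1r ltrDl powR_gt0.
Qed.

End kernel.

(** From [1 + s <= expR s] at [s = t / (2 * x)], raised to the power [x]. *)
Lemma powR_le_expR (R : realType) (x t : R) : 0 < x -> 0 < t ->
  t `^ x <= (2 * x) `^ x * expR (t / 2).
Proof.
move=> x0 t0; have x20 : 0 < 2 * x by rewrite mulr_gt0.
have {1}-> : t = 2 * x * (t / (2 * x)) by field; rewrite gt_eqF.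
have u0 : 0 <= t / (2 * x) by rewrite divr_ge0 ?ltW.
rewrite powRM ?(ltW x20)// ler_wpM2l ?powR_ge0//.
have -> : expR (t / 2) = expR (t / (2 * x)) `^ x.
  rewrite -expRM; congr expR; field; rewrite gt_eqF//.
apply: ge0_ler_powR; rewrite ?nnegrE ?expR_ge0 ?(ltW x0)//.
by apply: le_trans (expR_ge1Dx _); rewrite lerDr.
Qed.

(** The point is that Euler's integral is finite: [Gamma] is the finite part of
an extended integral, which would be 0 if the latter were infinite.  The integrand
is at most a constant times the log-logistic kernel of scale 1 and shape [x],
since [(1 + t `^ x) ^+ 2 * expR (- t)] is bounded. *)
Lemma Gamma_gt0 (R : realType) (x : R) : 0 < x -> 0 < Gamma x.
Proof.
move=> x0; pose h (t : R) := t `^ (x - 1) * expR (- t).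
have h0 t : (0 <= (h t)%:E)%E by rewrite lee_fin mulr_ge0 ?powR_ge0 ?expR_ge0.
apply: fine_gt0; apply/andP; split.
- pose c := 2^-1 * expR (- 2) : R.
  have c0 : 0 < c by rewrite mulr_gt0 ?expR_gt0.
  apply: (@lt_le_trans _ _ (c%:E * lebesgue_measure (`[1%R, 2%R] : set R))%E).
    rewrite lebesgue_measure_itv/= lte_fin ltr1n/= -EFinB -EFinM lte_fin.
    by rewrite mulr_gt0 ?subr_gt0 ?ltr1n.
  apply: integral_ge_cst => //.
  + by move=> t; rewrite /= !in_itv/= andbT => /andP[+ _]; exact: lt_le_trans.
  + exact: ltW.
  + by move=> t _; exact: h0.
  + move=> t; rewrite /= in_itv/= => /andP[t1 t2]; rewrite lee_fin.
    have t0 : 0 < t := lt_le_trans ltr01 t1.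
    rewrite ler_pM ?expR_ge0 ?ler_expR ?lerN2//.
    rewrite -(ler_pM2l t0) mulr_powRB1 ?(ltW t0)//.
    apply: (@le_trans _ _ 1); first by rewrite ler_pdivrMr ?mul1r.
    by rewrite -(powRr0 t); apply: ler_powR => //; exact: ltW.
- pose C := (1 + (2 * x) `^ x) ^+ 2.
  apply: (@le_lt_trans _ _ (C%:E * x^-1%:E)%E); last by rewrite -EFinM ltry.
  have C0 : 0 <= C by exact: sqr_ge0.
  apply: (@le_trans _ _ (C%:E *
    \int[lebesgue_measure]_(t in `]0%R, +oo[) (loglogistic 1 x t)%:E)%E); last first.
    by apply: lee_wpmul2l; rewrite ?lee_fin//; apply: integral_loglogistic_le.
  rewrite -ge0_integralZl//; last 2 first.
  + by apply/measurable_EFinP; apply: measurable_loglogistic.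
  + by move=> t _; rewrite lee_fin loglogistic_ge0.
  apply: le_integral_nonneg => t; first by move=> _; exact: h0.
  rewrite /= in_itv/= andbT => t0.
  rewrite -EFinM lee_fin /loglogistic powR1 mul1r mulrCA ler_wpM2l ?powR_ge0//.
  rewrite ler_pdivlMr ?exprn_gt0 ?ltr_wpDr ?powR_ge0//.
  rewrite mulrC -ler_pdivlMr ?expR_gt0// -expRN opprK.
  have -> : expR t = expR (t / 2) ^+ 2.
    by rewrite -expRM_natl; congr expR; field.
  rewrite -exprMn ler_pXn2r ?nnegrE ?addr_ge0 ?mulr_ge0 ?expR_ge0 ?powR_ge0 ?addr_ge0 ?powR_ge0//.
  rewrite mulrDl mul1r lerD ?powR_le_expR//.
  by rewrite -expR0 ler_expR divr_ge0 ?ltW.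
Qed.

(** * Positive definite matrices *)

Section posdef.
Context {R : realType} {k : nat}.
Implicit Types (A B : 'M[R]_k) (u v : 'cV[R]_k).

Definition bform A u v : R := (u^T *m A *m v) 0 0.

Lemma qformE A v : qform A v = bform A v v. Proof. by []. Qed.

Lemma bformDl A u v w : bform A (u + v) w = bform A u w + bform A v w.
Proof. by rewrite /bform linearD/= !mulmxDl mxE. Qed.

Lemma bformDr A u v w : bform A w (u + v) = bform A w u + bform A w v.
Proof. by rewrite /bform mulmxDr mxE. Qed.

Lemma bformZl A (a : R) u v : bform A (a *: u) v = a * bform A u v.
Proof. by rewrite /bform linearZ/= -!scalemxAl mxE. Qed.

Lemma bformZr A (a : R) u v : bform A u (a *: v) = a * bform A u v.
Proof. by rewrite /bform -scalemxAr mxE. Qed.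

Lemma bformC A u v : A^T = A -> bform A u v = bform A v u.
Proof.
move=> AT; have -> : bform A u v = (u^T *m A *m v)^T 0 0 by rewrite [RHS]mxE.
by rewrite !trmx_mul AT trmxK mulmxA.
Qed.

Lemma qformD A B v : qform (A + B) v = qform A v + qform B v.
Proof. by rewrite /qform mulmxDr mulmxDl mxE. Qed.

Lemma qformZ A (a : R) v : qform (a *: A) v = a * qform A v.
Proof. by rewrite /qform -scalemxAr -scalemxAl mxE. Qed.

Lemma qform_scale A (a : R) v : qform A (a *: v) = a ^+ 2 * qform A v.
Proof. by rewrite !qformE bformZl bformZr mulrA. Qed.

Lemma qform0 A : qform A 0 = 0.
Proof. by rewrite /qform mulmx0 mxE. Qed.

Lemma posdef_qform_ge0 A v : posdefmx A -> 0 <= qform A v.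
Proof. by move=> [_ pA]; have [->|/pA/ltW//] := eqVneq v 0; rewrite qform0. Qed.

Lemma posdefD A B : posdefmx A -> posdefmx B -> posdefmx (A + B).
Proof.
move=> [AT pA] [BT pB]; split=> [|v v0]; first by rewrite linearD/= AT BT.
by rewrite qformD addr_gt0 ?pA ?pB.
Qed.

Lemma posdefZ (a : R) A : 0 < a -> posdefmx A -> posdefmx (a *: A).
Proof.
move=> a0 [AT pA]; split=> [|v v0]; first by rewrite linearZ/= AT.
by rewrite qformZ mulr_gt0 ?pA.
Qed.

Lemma posdef1 : posdefmx (1%:M : 'M[R]_k).
Proof.
split=> [|v v0]; first by rewrite trmx1.
rewrite /qform mulmx1 mxE lt_def; apply/andP; split; last first.
  by apply: sumr_ge0 => i _; rewrite mxE -expr2 sqr_ge0.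
apply: contra v0 => /eqP/psumr_eq0P H; apply/eqP/colP => i; rewrite mxE.
apply/eqP; rewrite -sqrf_eq0 expr2; apply/eqP.
have := H _ i isT; rewrite mxE; apply => j _; rewrite mxE -expr2 sqr_ge0//.
Qed.

(** A kernel vector would have zero quadratic form. *)
Lemma posdef_unit A : posdefmx A -> A \in unitmx.
Proof.
move=> [AT pA]; rewrite -row_free_unit -kermx_eq0; apply/eqP/row_matrixP => i.
rewrite row0; apply/eqP; apply: contraT => r0.
have : 0 < qform A (row i (kermx A))^T.
  by apply: pA; apply: contra r0 => /eqP/(congr1 trmx); rewrite trmxK trmx0 => /eqP.
by rewrite /qform trmxK -row_mul mulmx_ker row0 mul0mx mxE ltxx.
Qed.

Lemma trmx_invmx A : A^T = A -> (invmx A)^T = invmx A.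
Proof. by move=> AT; rewrite trmx_inv AT. Qed.

Lemma qform_inv A v : posdefmx A -> qform (invmx A) v = qform A (invmx A *m v).
Proof.
move=> pA; have uA := posdef_unit _ pA; case: pA => AT _.
by rewrite /qform trmx_mul trmx_invmx// -!mulmxA mulKVmx.
Qed.

Lemma posdef_inv A : posdefmx A -> posdefmx (invmx A).
Proof.
move=> pA; have uA := posdef_unit _ pA; split; first by case: pA => /trmx_invmx.
move=> v v0; rewrite qform_inv//; apply: (proj2 pA).
by apply: contra v0 => /eqP/(congr1 (mulmx A)); rewrite mulKVmx// mulmx0 => /eqP.
Qed.

(** The Cauchy-Schwarz inequality for the inner product [A], applied to [u] and
[w = invmx A *m v], because [bform A u w] is the standard inner product of [u] and
[v].  All the estimates on inverse matrices below come from this inequality. *)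
Lemma posdef_cauchy A u v : posdefmx A ->
  bform 1%:M u v ^+ 2 <= qform A u * qform (invmx A) v.
Proof.
move=> pA; have uA := posdef_unit _ pA.
have [->|v0] := eqVneq v 0.
  by rewrite qform0 mulr0 /bform mulmx0 mxE expr0n.
set x := qform (invmx A) v; set y := bform _ u v.
have x0 : 0 < x by apply: (proj2 (posdef_inv _ pA)).
pose w := invmx A *m v.
have yE : y = bform A u w by rewrite /y /bform /w mulmx1 -!mulmxA mulKVmx.
have xE : x = bform A w w by rewrite /x qform_inv.
have : 0 <= qform A (x *: u + (- y) *: w) by apply: posdef_qform_ge0.
(* Expanded, this is the discriminant inequality multiplied by x. *)
rewrite qformE !bformDl !bformDr !bformZl !bformZr -xE.
rewrite (bformC A w u (proj1 pA)) -yE -qformE => H.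
suff : 0 <= x * (qform A u * x - y ^+ 2) by rewrite pmulr_rge0// subr_ge0.
by apply: le_trans H _; rewrite le_eqVlt; apply/orP; left; apply/eqP; ring.
Qed.

Lemma qform_le_sqnorm A : exists2 L : R, 0 < L &
  forall v, qform A v <= L * qform 1%:M v.
Proof.
pose L := \sum_i \sum_j `|A i j|.
have L0 : 0 <= L by apply: sumr_ge0 => i _; apply: sumr_ge0.
exists (L + 1) => [|v]; first by rewrite ltr_wpDl.
have nE : qform 1%:M v = \sum_i v i 0 ^+ 2.
  by rewrite /qform mulmx1 mxE; apply: eq_bigr => i _; rewrite mxE.
have n0 : 0 <= qform 1%:M v by exact: posdef_qform_ge0 posdef1.
have vi i : v i 0 ^+ 2 <= qform 1%:M v.
  rewrite nE (bigD1 i)//= lerDl sumr_ge0// => j _; exact: sqr_ge0.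
apply: (@le_trans _ _ (L * qform 1%:M v)); last by rewrite ler_wpM2r// lerDl.
rewrite {1}/qform mxE /L exchange_big/= mulr_suml.
apply: ler_sum => j _; rewrite mxE !mulr_suml; apply: ler_sum => i _; rewrite mxE.
have -> : v i 0 * A i j * v j 0 = A i j * (v j 0 * v i 0) by ring.
apply: le_trans (ler_norm _) _; rewrite normrM ler_wpM2l//.
rewrite ler_norml; have := vi i; have := vi j.
have := sqr_ge0 (v i 0 + v j 0); have := sqr_ge0 (v i 0 - v j 0).
by move=> *; apply/andP; split; nra.
Qed.

(** Cauchy-Schwarz with [u = v] turns an upper bound for the form of the inverse
into a lower bound for the form of [A]. *)
Lemma posdef_sqnorm_le A : posdefmx A -> exists2 c : R, 0 < c &
  forall v, c * qform 1%:M v <= qform A v.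
Proof.
move=> pA; have [L L0 HL] := qform_le_sqnorm (invmx A).
exists L^-1 => [|v]; first by rewrite invr_gt0.
rewrite mulrC ler_pdivrMr//.
have [->|v0] := eqVneq v 0; first by rewrite !qform0 mul0r.
have t0 : 0 < qform 1%:M v by apply: (proj2 posdef1).
rewrite -(ler_pM2r t0) -expr2 -mulrA.
apply: le_trans (posdef_cauchy _ _ _ pA) _.
by rewrite ler_wpM2l ?posdef_qform_ge0.
Qed.

Lemma posdef_pencil A B (g : R) : posdefmx A -> posdefmx B -> 0 < g ->
  posdefmx (A + g *: B).
Proof. by move=> pA pB g0; apply: posdefD => //; exact: posdefZ. Qed.

(** With [S = A + g *: B], [q = v' S^-1 v] and [w = S^-1 v] one has
[g * qform B w <= qform S w = q], and Cauchy-Schwarz for [B] gives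
[q ^+ 2 <= qform B w * qform (invmx B) v].  Dividing by [q] yields the bound. *)
Lemma qform_inv_pencil_le A B : posdefmx A -> posdefmx B ->
  exists2 L : R, 0 < L & forall (g : R) v, 0 < g ->
    qform (invmx (A + g *: B)) v <= L * qform 1%:M v / g.
Proof.
move=> pA pB; have [L L0 HL] := qform_le_sqnorm (invmx B).
exists L => // g v g0; set S := A + g *: B.
have pS : posdefmx S by exact: posdef_pencil.
set q := qform _ v.
have [q0|q0] := leP q 0.
  rewrite (le_trans q0)// divr_ge0 ?mulr_ge0 ?(ltW g0) ?(ltW L0)// posdef_qform_ge0//.
  exact: posdef1.
apply: le_trans (_ : qform (invmx B) v / g <= _); last first.
  by rewrite ler_pM2r ?invr_gt0.
rewrite ler_pdivlMr// -(ler_pM2l q0).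
pose w := invmx S *m v.
have qE : q = bform 1%:M w v.
  by rewrite /q /bform /qform mulmx1 trmx_mul trmx_invmx//; case: pS.
have gB : g * qform B w <= q.
  by rewrite /q qform_inv// qformD qformZ lerDr posdef_qform_ge0.
rewrite mulrA -expr2 {1}qE.
have := posdef_cauchy _ w v pB.
move/(ler_wpM2r (ltW g0))/le_trans; apply.
by rewrite mulrC mulrA ler_wpM2r// posdef_qform_ge0//; exact: posdef_inv.
Qed.

(** Cauchy-Schwarz for [A + g *: B] with both vectors equal to [v]; the form of
[A + g *: B] at [v] grows at most like [1 + g]. *)
Lemma qform_inv_pencil_ge A B v : posdefmx A -> posdefmx B -> v != 0 ->
  exists2 l : R, 0 < l & forall g : R, 0 < g ->
    l / (1 + g) <= qform (invmx (A + g *: B)) v.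
Proof.
move=> pA pB v0; have t0 : 0 < qform 1%:M v by apply: (proj2 posdef1).
have a0 : 0 < qform A v by apply: (proj2 pA).
have b0 : 0 < qform B v by apply: (proj2 pB).
exists (qform 1%:M v ^+ 2 / (qform A v + qform B v)).
  by rewrite divr_gt0 ?exprn_gt0 ?addr_gt0.
move=> g g0; have g1 : 0 < 1 + g by rewrite addr_gt0.
have pS := posdef_pencil _ _ _ pA pB g0.
rewrite ler_pdivrMr// ler_pdivrMr ?addr_gt0//.
apply: le_trans (posdef_cauchy _ v v pS) _.
rewrite mulrC -mulrA ler_wpM2l ?posdef_qform_ge0//; first exact: posdef_inv.
rewrite qformD qformZ; nra.
Qed.

(** The determinant is the evaluation at [s] of a polynomial determinant. *)
Lemma continuous_det_line A B : continuous (fun s : R => \det ((1 - s) *: A + s *: B)).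
Proof.
pose P := \det (map_mx polyC A + 'X *: map_mx polyC (B - A)).
suff -> : (fun s : R => \det ((1 - s) *: A + s *: B)) = horner P.
  exact: continuous_horner.
apply/funext => s; rewrite -horner_evalE -det_map_mx; congr (\det _).
apply/matrixP => i j; rewrite !mxE/= horner_evalE !hornerE; ring.
Qed.

Lemma posdef_segment A B (s : R) : posdefmx A -> posdefmx B -> 0 <= s <= 1 ->
  posdefmx ((1 - s) *: A + s *: B).
Proof.
move=> pA pB /andP[s0 s1].
have [->|sn0] := eqVneq s 0; first by rewrite subr0 scale0r addr0 scale1r.
have [->|sn1] := eqVneq s 1; first by rewrite subrr scale0r add0r scale1r.
apply: posdefD; apply: posdefZ => //; last by rewrite lt_def sn0.
by rewrite subr_gt0 lt_def eq_sym sn1.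
Qed.

(** The segment from the identity to [A] stays among positive definite, hence
invertible, matrices; by the intermediate value theorem the determinant, equal to
1 at the identity, cannot have become negative at [A]. *)
Lemma posdef_det_gt0 A : posdefmx A -> 0 < \det A.
Proof.
move=> pA; rewrite ltNge; apply/negP => A0.
pose h (s : R) := \det ((1 - s) *: 1%:M + s *: A).
have h0 : h 0 = 1 by rewrite /h subr0 scale0r addr0 scale1r det1.
have h1 : h 1 = \det A by rewrite /h subrr scale0r add0r scale1r.
have [||c c01 hc] := @IVT R h 0 1 0 ler01.
- by apply: continuous_subspaceT; exact: continuous_det_line.
- by rewrite h0 h1 ge_min le_max A0 ler01 orbT.
have := posdef_unit _ (posdef_segment _ _ c posdef1 pA c01).
by rewrite unitmxE -/(h c) hc unitr0.
Qed.

(** Homogenizing, [A + g *: B] is [1 + g] times the point with parameter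
[s = g / (1 + g)] of the segment from [A] to [B].  On this compact segment the
determinant is continuous and positive, so it has a positive minimum and a
maximum. *)
Lemma det_pencil_bounds A B : posdefmx A -> posdefmx B ->
  exists d D : R, [/\ 0 < d, 0 < D & forall g : R, 0 < g ->
    d * (1 + g) ^+ k <= \det (A + g *: B) <= D * (1 + g) ^+ k].
Proof.
move=> pA pB; pose h (s : R) := \det ((1 - s) *: A + s *: B).
have ch : {within `[0, 1], continuous h}.
  by apply: continuous_subspaceT; exact: continuous_det_line.
have [a a01 ha] := EVT_min (@ler01 R) ch.
have [b b01 hb] := EVT_max (@ler01 R) ch.
have hp s : s \in `[0, 1] -> 0 < h s.
  by move=> s01; apply: posdef_det_gt0; apply: posdef_segment.
exists (h a), (h b); split; [exact: hp|exact: hp|move=> g g0].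
have g1 : 0 < 1 + g by rewrite addr_gt0.
have -> : \det (A + g *: B) = h (g / (1 + g)) * (1 + g) ^+ k.
  rewrite mulrC -detZ; congr (\det _).
  rewrite scalerDr !scalerA.
  have -> : (1 + g) * (1 - g / (1 + g)) = 1 by field; rewrite gt_eqF.
  have -> : (1 + g) * (g / (1 + g)) = g by field; rewrite gt_eqF.
  by rewrite scale1r.
have s01 : g / (1 + g) \in `[0, 1].
  by rewrite in_itv/= divr_ge0 ?(ltW g0) ?(ltW g1)//= ler_pdivrMr// mul1r lerDr.
by rewrite !ler_pM2r ?exprn_gt0// ha// hb.
Qed.

End posdef.

Lemma enormE (R : realType) (k : nat) (v : 'cV[R]_k) :
  enorm v = Num.sqrt (qform 1%:M v).
Proof.
rewrite /enorm /qform mulmx1 mxE; congr (Num.sqrt _); apply: eq_bigr => i _.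
by rewrite mxE.
Qed.

(** * Data with a prescribed estimate and residual *)

Section data.
Context {R : realType} {n r1 r2 : nat}.
Variables (Xt : 'M[R]_(n, r1)) (Xg : 'M[R]_(n, r2)) (Sigma : 'M[R]_n).
Hypothesis Sigma_pd : posdefmx Sigma.

Lemma posdef_info : \rank (row_mx Xt Xg) = (r1 + r2)%N -> posdefmx (info Xt Sigma).
Proof.
move=> rk; have pS := posdef_inv _ Sigma_pd.
split=> [|v v0]; first by rewrite /info !trmx_mul trmxK (proj1 pS) mulmxA.
have -> : qform (info Xt Sigma) v = qform (invmx Sigma) (Xt *m v).
  by rewrite /qform /info trmx_mul !mulmxA.
apply: (proj2 pS); apply: contra v0 => /eqP Xv.
have fr : row_free (row_mx Xt Xg)^T by rewrite /row_free mxrank_tr rk.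
have : (col_mx v (0 : 'cV[R]_r2))^T *m (row_mx Xt Xg)^T = 0 *m (row_mx Xt Xg)^T.
  by rewrite mul0mx -trmx_mul mul_row_col mulmx0 addr0 Xv trmx0.
move/(row_free_inj fr)/(congr1 trmx); rewrite trmxK trmx0 -col_mx0.
by move=> /eq_col_mx[-> _].
Qed.

(** Fewer than [n] linear conditions have a nonzero common solution, which is then
rescaled. *)
Lemma exists_residual (s2 : R) : (r1 + r2 < n)%N -> 0 < s2 ->
  exists w : 'cV[R]_n, [/\ Xt^T *m invmx Sigma *m w = 0,
    Xg^T *m invmx Sigma *m w = 0 & qform (invmx Sigma) w = s2].
Proof.
move=> n_gt s20; pose N := col_mx Xt^T Xg^T *m invmx Sigma.
have : kermx N^T != 0.
  rewrite -mxrank_eq0 mxrank_ker mxrank_tr -lt0n subn_gt0.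
  exact: leq_ltn_trans (rank_leq_row N) n_gt.
move=> /rowV0Pn[v /sub_kermxP vN v0].
have : N *m v^T = 0 by rewrite -[N]trmxK -trmx_mul vN trmx0.
rewrite /N mul_col_mx mul_col_mx -col_mx0 => /eq_col_mx[Ht Hg].
have q0 : 0 < qform (invmx Sigma) v^T.
  apply: (proj2 (posdef_inv _ Sigma_pd)).
  by apply: contra v0 => /eqP/(congr1 trmx); rewrite trmxK trmx0 => /eqP.
exists (Num.sqrt (s2 / qform (invmx Sigma) v^T) *: v^T); split.
- by rewrite -scalemxAr Ht scaler0.
- by rewrite -scalemxAr Hg scaler0.
- rewrite qform_scale sqr_sqrtr ?divr_ge0 ?ltW// divfK// gt_eqF//.
Qed.

(** For a vector [w] orthogonal to both designs in the metric [invmx Sigma],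
[Xt *m theta + w] has estimate
[theta] and residual [w]: the estimate can be prescribed freely while the residual
sum of squares is kept fixed. *)
Lemma gls_data (theta : 'cV[R]_r1) (w : 'cV[R]_n) :
  info Xt Sigma \in unitmx -> Xt^T *m invmx Sigma *m w = 0 ->
  gls Xt Sigma (Xt *m theta + w) = theta.
Proof.
move=> uI w0; rewrite /gls mulmxDr w0 addr0.
by rewrite [X in invmx _ *m X]mulmxA mulKmx.
Qed.

Lemma resid_ss_data (theta : 'cV[R]_r1) (w : 'cV[R]_n) :
  info Xt Sigma \in unitmx -> Xt^T *m invmx Sigma *m Xg = 0 ->
  Xt^T *m invmx Sigma *m w = 0 -> Xg^T *m invmx Sigma *m w = 0 ->
  resid_ss Xt Xg Sigma (Xt *m theta + w) = qform (invmx Sigma) w.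
Proof.
move=> uI Xorth wt wg; rewrite /resid_ss gls_data//.
have Xorth' : Xg^T *m invmx Sigma *m Xt = 0.
  have := congr1 trmx Xorth.
  by rewrite !trmx_mul trmxK trmx0 (proj1 (posdef_inv _ Sigma_pd)) mulmxA.
have -> : gls Xg Sigma (Xt *m theta + w) = 0.
  by rewrite /gls mulmxDr mulmxA Xorth' mul0mx wg addr0 mulmx0.
by rewrite mulmx0 subr0 addrAC subrr add0r.
Qed.

End data.

(** * Domination by the log-logistic kernel *)

Section powR.
Context {R : realType}.
Implicit Types x y a b u T g d : R.

Lemma ge0_powRN_le x y a : 0 <= a -> 0 < x -> x <= y -> y `^ (- a) <= x `^ (- a).
Proof.
move=> a0 x0 xy; have y0 := lt_le_trans x0 xy.
rewrite !powRN lef_pV2 ?posrE ?powR_gt0//.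
by apply: ge0_ler_powR; rewrite ?nnegrE ?(ltW x0) ?(ltW y0).
Qed.

Lemma gt0_powRD x a b : 0 < x -> x `^ (a + b) = x `^ a * x `^ b.
Proof. by move=> x0; rewrite powRD//; apply/implyP => _; rewrite gt_eqF. Qed.

Lemma gt0_powR_div x y a : 0 < x -> 0 < y -> (x / y) `^ a = x `^ a * y `^ (- a).
Proof.
move=> x0 y0; rewrite powRM ?invr_ge0 ?ltW//; congr (_ * _).
by rewrite -[y^-1]powR_inv1 ?ltW// -powRrM mulN1r.
Qed.

(** Both sides behave as powers of [u] at 0 and at +oo; the hypotheses on [d] say
that the left side decays at least as fast at each end, as
[u `^ (a0 - d) <= (1 + u) `^ (a0 - d) <= (1 + u) `^ (a1 - 2 d)].  The factor 4 is
the square of the constant in [1 + u `^ d <= 2 (1 + u) `^ d]. *)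
Lemma powR_ratio_le u a0 a1 d : 0 < u -> 0 <= d -> d <= a0 -> d <= a1 - a0 ->
  u `^ a0 * (1 + u) `^ (- a1) <= 4 * (u `^ d / (u `^ d + 1) ^+ 2).
Proof.
move=> u0 d0 da0 da1; have u1 : 0 < 1 + u by rewrite addr_gt0.
have P0 : 0 < u `^ d by exact: powR_gt0.
have Q0 : 0 < (1 + u) `^ d by exact: powR_gt0.
have PQ : u `^ d <= (1 + u) `^ d.
  by apply: ge0_ler_powR; rewrite ?nnegrE ?(ltW u0) ?(ltW u1)// lerDr.
have Q1 : 1 <= (1 + u) `^ d.
  by rewrite -[leLHS](powRr0 (1 + u)); apply: ler_powR => //; rewrite lerDl ltW.
rewrite mulrA ler_pdivlMr ?exprn_gt0 ?addr_gt0//.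
apply: (@le_trans _ _ (u `^ a0 * (1 + u) `^ (- a1) * (4 * ((1 + u) `^ d) ^+ 2))).
  rewrite ler_wpM2l ?mulr_ge0 ?powR_ge0//.
  by rewrite -subr_ge0; nra.
have -> : u `^ a0 = u `^ (a0 - d) * u `^ d by rewrite -gt0_powRD// subrK.
have : u `^ (a0 - d) * ((1 + u) `^ (- a1) * ((1 + u) `^ d) ^+ 2) <= 1.
  rewrite expr2 -!gt0_powRD//.
  apply: le_trans (_ : (1 + u) `^ (a0 - d) * (1 + u) `^ (- a1 + (d + d)) <= _).
    rewrite ler_wpM2r ?powR_ge0//.
    by apply: ge0_ler_powR; rewrite ?nnegrE ?(ltW u0) ?(ltW u1) ?subr_ge0// lerDr.
  rewrite -gt0_powRD// -[leRHS](powRr0 (1 + u)); apply: ler_powR; first by rewrite lerDl ltW.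
  lra.
move=> H; have := ler_wpM2l (ltW (mulr_gt0 (ltr0Sn R 3) P0)) H.
rewrite mulr1; apply: le_trans; rewrite le_eqVlt; apply/orP; left; apply/eqP; ring.
Qed.

(** The kernel is [g^-1] times a function of [T / g] alone. *)
Lemma loglogisticE T d g : 0 < T -> 0 < g ->
  loglogistic T d g = g^-1 * ((T / g) `^ d / ((T / g) `^ d + 1) ^+ 2).
Proof.
move=> T0 g0; rewrite /loglogistic gt0_powR_div// gt0_powRD// powR_inv1 ?ltW// powRN.
have := powR_gt0 d T0; have := powR_gt0 d g0.
set P := T `^ d; set Q := g `^ d => Q0 P0.
by field; rewrite !gt_eqF ?addr_gt0.
Qed.

Lemma le_loglogistic T g a0 a1 d : 0 < T -> 0 < g -> 0 <= d -> d <= a0 -> d <= a1 - a0 ->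
  T `^ a0 * g `^ (- (a0 + 1)) * (1 + T / g) `^ (- a1) <= 4 * loglogistic T d g.
Proof.
move=> T0 g0 d0 da0 da1; have u0 : 0 < T / g by rewrite divr_gt0.
have -> : T `^ a0 * g `^ (- (a0 + 1)) * (1 + T / g) `^ (- a1) =
    g^-1 * ((T / g) `^ a0 * (1 + T / g) `^ (- a1)).
  by rewrite gt0_powR_div// opprD gt0_powRD// powR_inv1 ?(ltW g0)//; ring.
rewrite loglogisticE// [leRHS]mulrCA ler_wpM2l ?invr_ge0 ?(ltW g0)//.
exact: powR_ratio_le.
Qed.
End powR.

(** * Bounds on the conditional Bayes factor *)

Lemma kappa_gt0 (R : realType) (nu s : R) : 0 < s -> 0 < kappa nu s.
Proof.
move=> s0; rewrite /kappa; case: ifPn => // nu0.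
have h0 : 0 < nu / 2 by rewrite divr_gt0.
by rewrite divr_gt0 ?Gamma_gt0// mulr_gt0 ?powR_gt0.
Qed.

Section bayes_factor.
Context {R : realType} {n r1 r2 : nat}.
Variables (Xt : 'M[R]_(n, r1)) (Xg : 'M[R]_(n, r2)) (Sigma : 'M[R]_n).
Variables (Omega : 'M[R]_r1) (nu0 s0 nu1 s1 s2 : R).
Hypotheses (info_pd : posdefmx (info Xt Sigma)) (Omega_pd : posdefmx Omega).
Hypotheses (r2_lt : (r2 < n)%N) (nu0_ge0 : 0 <= nu0) (nu1_ge0 : 0 <= nu1).
Hypotheses (s0_gt0 : 0 < s0) (s1_gt0 : 0 < s1) (s2_gt0 : 0 < s2).

Local Notation a0 := (half_df n r2 nu0).
Local Notation a1 := (half_df n r2 nu1).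
Local Notation I := (info Xt Sigma).
Local Notation bf := (BF_given Xt Xg Sigma Omega nu0 s0 nu1 s1).

Lemma half_df_gt0 (nu : R) : 0 <= nu -> 0 < half_df n r2 nu.
Proof.
by move=> nu_ge0; rewrite /half_df divr_gt0// addrAC ltr_wpDr// subr_gt0 ltr_nat.
Qed.

Let c1 := s1 ^+ 2 * nu1 + s2.
Let c0 := s0 ^+ 2 * nu0 + s2.

Let c1_gt0 : 0 < c1.
Proof. by rewrite /c1 ltr_wpDl// mulr_ge0// sqr_ge0. Qed.

Let c0_gt0 : 0 < c0.
Proof. by rewrite /c0 ltr_wpDl// mulr_ge0// sqr_ge0. Qed.

Let powR_scale_expn (d x : R) : 0 < d -> 0 < x ->
  (d * x ^+ r1) `^ (- 2^-1) = d `^ (- 2^-1) * x `^ (- (r1%:R / 2)).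
Proof.
move=> d0 x0; rewrite powRM ?exprn_ge0 ?ltW//; congr (_ * _).
by rewrite -powR_mulrn ?ltW// -powRrM mulrN.
Qed.

(** The constant gathers every factor of the conditional Bayes factor that depends
neither on [g] nor on the data. *)
Lemma BF_givenE : exists2 C : R, 0 < C & forall (y : 'cV[R]_n) (g : R),
  resid_ss Xt Xg Sigma y = s2 ->
  bf y g = C * \det (invmx I + g *: Omega) `^ (- 2^-1) *
    ((c1 + qform (invmx (invmx I + g *: Omega)) (gls Xt Sigma y)) `^ (- a1) *
     (c0 + qform I (gls Xt Sigma y)) `^ a0).
Proof.
exists (kappa nu1 s1 * Gamma a1 / (kappa nu0 s0 * Gamma a0) *
    2 `^ ((nu1 - nu0) / 2) * \det I `^ (- 2^-1)).
  have := posdef_det_gt0 _ info_pd => dI.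
  by rewrite !mulr_gt0 ?invr_gt0 ?mulr_gt0 ?powR_gt0 ?kappa_gt0 ?Gamma_gt0 ?half_df_gt0.
move=> y g ys; rewrite /BF_given /C1 ys -/c1 -/c0 [g *: _ + _]addrC.
rewrite [(c0 + _) `^ (- a0)]powRN invrK.
by congr (_ * _); rewrite mulrAC.
Qed.

Lemma BF_given_ge0 y g : resid_ss Xt Xg Sigma y = s2 -> 0 <= bf y g.
Proof.
move=> ys; have [C C0 ->//] := BF_givenE.
by rewrite !mulr_ge0 ?powR_ge0 ?(ltW C0).
Qed.

(** For [g] between [tau] and [2 * tau] the determinant is at most of order
[tau ^+ r1], the form [Q(g)] is bounded, and the null-model term is at least of
order [tau `^ a0]. *)
Lemma BF_given_ge : exists2 E : R, 0 < E & forall (y : 'cV[R]_n) (g : R),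
  let tau := qform 1%:M (gls Xt Sigma y) in
  resid_ss Xt Xg Sigma y = s2 -> 1 <= tau -> tau <= g <= 2 * tau ->
  E * tau `^ (a0 - r1%:R / 2) <= bf y g.
Proof.
have [C C0 bfE] := BF_givenE.
have pA := posdef_inv _ info_pd.
have [d [D [_ D0 HD]]] := det_pencil_bounds _ _ pA Omega_pd.
have [L L0 HL] := qform_inv_pencil_le _ _ pA Omega_pd.
have [c cgt0 Hc] := posdef_sqnorm_le _ info_pd.
exists (C * (D * 3 ^+ r1) `^ (- 2^-1) * ((c1 + L) `^ (- a1) * c `^ a0)).
  by rewrite !mulr_gt0 ?powR_gt0 ?mulr_gt0 ?exprn_gt0 ?(addr_gt0 c1_gt0 L0).
move=> y g tau ys tau1 /andP[taug gtau].
have tau0 : 0 < tau := lt_le_trans ltr01 tau1.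
have g0 : 0 < g := lt_le_trans tau0 taug.
have pS := posdef_pencil _ _ _ pA Omega_pd g0.
rewrite bfE// [a0 - _]addrC gt0_powRD//.
set th := gls Xt Sigma y.
have Q0 : 0 <= qform (invmx (invmx I + g *: Omega)) th.
  by apply: posdef_qform_ge0; exact: posdef_inv.
have -> : C * (D * 3 ^+ r1) `^ (- 2^-1) * ((c1 + L) `^ (- a1) * c `^ a0) *
    (tau `^ (- (r1%:R / 2)) * tau `^ a0) =
    C * ((D * 3 ^+ r1) `^ (- 2^-1) * tau `^ (- (r1%:R / 2))) *
    ((c1 + L) `^ (- a1) * (c `^ a0 * tau `^ a0)) by ring.
apply: ler_pM; rewrite ?mulr_ge0 ?powR_ge0 ?(ltW C0)//.
- rewrite ler_pM2l// -powR_scale_expn ?mulr_gt0 ?exprn_gt0//.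
  apply: ge0_powRN_le; rewrite ?invr_ge0//; first exact: posdef_det_gt0.
  have /andP[_ /le_trans] := HD g g0; apply.
  rewrite -mulrA -exprMn ler_pM2l//; apply: lerXn2r; rewrite ?nnegrE; lra.
- apply: ler_pM; rewrite ?mulr_ge0 ?powR_ge0//.
    apply: ge0_powRN_le; rewrite ?(ltW (half_df_gt0 _ nu1_ge0))//.
      by rewrite ltr_wpDr.
    rewrite lerD2l; apply: le_trans (HL g th g0) _.
    by rewrite ler_pdivrMr// ler_pM2l.
  rewrite -powRM ?(ltW cgt0) ?(ltW tau0)//.
  apply: ge0_ler_powR; rewrite ?nnegrE ?(ltW (half_df_gt0 _ nu0_ge0))//.
  + by rewrite mulr_ge0 ?ltW.
  + by rewrite addr_ge0 ?(ltW c0_gt0)// posdef_qform_ge0.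
  + by apply: le_trans (Hc th) _; rewrite lerDr ltW.
Qed.

(** Along the fixed direction [e] the lower bounds for the determinant and for
[Q(g)] hold with constants independent of [g] and [t].  The additive constants
[c1] and [c0] are absorbed using [t >= 1]. *)
Lemma BF_given_le (e : 'cV[R]_r1) : e != 0 ->
  exists2 E : R, 0 < E & forall (y : 'cV[R]_n) (t g : R),
    resid_ss Xt Xg Sigma y = s2 -> gls Xt Sigma y = t *: e -> 1 <= t -> 0 < g ->
    bf y g <= E * ((1 + g) `^ (- (r1%:R / 2)) *
      ((1 + t ^+ 2 / (1 + g)) `^ (- a1) * (t ^+ 2) `^ a0)).
Proof.
move=> e0; have [C C0 bfE] := BF_givenE.
have pA := posdef_inv _ info_pd.
have [d [D [d0 _ Hd]]] := det_pencil_bounds _ _ pA Omega_pd.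
have [l l0 Hl] := qform_inv_pencil_ge _ _ _ pA Omega_pd e0.
pose q := qform I e; have q0 : 0 < q by apply: (proj2 info_pd).
pose m := Num.min c1 l; have m0 : 0 < m by rewrite lt_min c1_gt0.
exists (C * d `^ (- 2^-1) * (m `^ (- a1) * (c0 + q) `^ a0)).
  by rewrite !mulr_gt0 ?powR_gt0 ?(addr_gt0 c0_gt0 q0).
move=> y t g ys yt t1 g0.
have T0 : 0 < t ^+ 2 by rewrite exprn_gt0// (lt_le_trans ltr01).
have T1 : 1 <= t ^+ 2 by rewrite exprn_ege1.
have g1 : 0 < 1 + g by rewrite addr_gt0.
have pS := posdef_pencil _ _ _ pA Omega_pd g0.
have u0 : 0 < t ^+ 2 / (1 + g) by rewrite divr_gt0.
rewrite bfE// yt !qform_scale -/q.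
have -> : C * d `^ (- 2^-1) * (m `^ (- a1) * (c0 + q) `^ a0) *
    ((1 + g) `^ (- (r1%:R / 2)) *
      ((1 + t ^+ 2 / (1 + g)) `^ (- a1) * (t ^+ 2) `^ a0)) =
    C * (d `^ (- 2^-1) * (1 + g) `^ (- (r1%:R / 2))) *
    ((m `^ (- a1) * (1 + t ^+ 2 / (1 + g)) `^ (- a1)) *
     ((c0 + q) `^ a0 * (t ^+ 2) `^ a0)) by ring.
apply: ler_pM; rewrite ?mulr_ge0 ?powR_ge0 ?(ltW C0)//.
- rewrite ler_pM2l// -powR_scale_expn//.
  apply: ge0_powRN_le; rewrite ?invr_ge0 ?mulr_gt0 ?exprn_gt0//.
  by have /andP[] := Hd g g0.
- apply: ler_pM; rewrite ?mulr_ge0 ?powR_ge0//.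
    rewrite -powRM ?(ltW m0) ?addr_ge0 ?(ltW u0)//.
    apply: ge0_powRN_le; rewrite ?(ltW (half_df_gt0 _ nu1_ge0))//.
      by rewrite mulr_gt0// addr_gt0.
    rewrite mulrDr mulr1 lerD ?ge_min ?lexx//.
    apply: (@le_trans _ _ (t ^+ 2 * (l / (1 + g)))); last by rewrite ler_pM2l// Hl.
    by rewrite mulrCA ler_pM2l// ler_pM2r ?invr_gt0// ge_min lexx orbT.
  have cq0 := addr_gt0 c0_gt0 q0.
  rewrite -powRM ?(ltW T0) ?(ltW cq0)//.
  apply: ge0_ler_powR; rewrite ?nnegrE ?(ltW (half_df_gt0 _ nu0_ge0))//.
  + exact: addr_ge0 (ltW c0_gt0) (mulr_ge0 (ltW T0) (ltW q0)).
  + exact: mulr_ge0 (ltW cq0) (ltW T0).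
  + by rewrite mulrDl [q * _]mulrC lerD2r ler_peMr// ltW.
Qed.

End bayes_factor.

(** * Small and large values of g *)

Section scalar_bounds.
Context {R : realType}.
Implicit Types T M g r al : R.

(** The upper bound of [BF_given_le] without its constant, at [T = t ^+ 2] and
[r = r1 / 2]. *)
Let bound r (a0 a1 : R) T g : R :=
  (1 + g) `^ (- r) * ((1 + T / (1 + g)) `^ (- a1) * T `^ a0).

(** Here [1 + T / (1 + g) >= T / (1 + M)], and the remaining power
[T `^ (a0 - a1)] is at most 1. *)
Lemma bound_small_g r a0 a1 M T g : 0 <= r -> 0 <= a1 -> a0 <= a1 ->
  1 <= T -> 0 < g -> g <= M -> bound r a0 a1 T g <= (1 + M) `^ a1.
Proof.
move=> r0 a10 a01 T1 g0 gM.
have T0 : 0 < T := lt_le_trans ltr01 T1.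
have g1 : 0 < 1 + g by rewrite addr_gt0.
have M1 : 0 < 1 + M by rewrite (lt_le_trans g1)// lerD2l.
rewrite /bound -[leRHS]mul1r; apply: ler_pM; rewrite ?mulr_ge0 ?powR_ge0//.
  rewrite -[leRHS](powRr0 (1 + g)); apply: ler_powR; first by rewrite lerDl ltW.
  by rewrite oppr_le0.
apply: (@le_trans _ _ ((T / (1 + M)) `^ (- a1) * T `^ a0)).
  rewrite ler_wpM2r ?powR_ge0//; apply: ge0_powRN_le => //; first by rewrite divr_gt0.
  by rewrite ler_wpDl// ler_pM2l// lef_pV2// lerD2l.
rewrite gt0_powR_div// opprK mulrAC -gt0_powRD// -[leRHS]mul1r ler_wpM2r ?powR_ge0//.
by rewrite -[leRHS](powRr0 T); apply: ler_powR => //; lra.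
Qed.

(** For [g >= M] the quantities [g] and [1 + g] are comparable, with ratio at least
[b = M / (1 + M)], and the surplus of [r + al] over [a0 + 1] only contributes a
nonpositive power of [g], bounded by its value at [M].  What is left is the
integrand of [le_loglogistic]. *)
Lemma bound_large_g r a0 a1 al d M : 0 < M -> 0 <= r -> 0 <= a1 ->
  0 <= d -> d <= a0 -> d <= a1 - a0 -> a0 + 1 <= r + al ->
  exists2 B : R, 0 < B & forall T g, 0 < T -> M <= g ->
    bound r a0 a1 T g * g `^ (- al) <= B * loglogistic T d g.
Proof.
move=> M0 r0 a10 d0 da0 da1 ral; pose b := M / (1 + M).
have M1 : 0 < 1 + M by rewrite addr_gt0.
have b0 : 0 < b by rewrite divr_gt0.
exists (4 * (b `^ (- a1) * M `^ (- (r + al - (a0 + 1))))).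
  by rewrite !mulr_gt0 ?powR_gt0.
move=> T g T0 Mg; have g0 : 0 < g := lt_le_trans M0 Mg.
have g1 : 0 < 1 + g by rewrite addr_gt0.
have K0 : 0 <= b `^ (- a1) * M `^ (- (r + al - (a0 + 1))) by rewrite mulr_ge0 ?powR_ge0.
rewrite [leRHS]mulrAC [leRHS]mulrC.
apply: le_trans (ler_wpM2l K0 (le_loglogistic _ _ _ _ _ T0 g0 d0 da0 da1)).
have gpow : g `^ (- r) * g `^ (- al) <=
    M `^ (- (r + al - (a0 + 1))) * g `^ (- (a0 + 1)).
  rewrite -gt0_powRD//.
  have -> : - r - al = - (r + al - (a0 + 1)) + - (a0 + 1) by ring.
  rewrite gt0_powRD// ler_wpM2r ?powR_ge0//.
  by apply: ge0_powRN_le; rewrite ?subr_ge0.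
have gr : (1 + g) `^ (- r) <= g `^ (- r) by apply: ge0_powRN_le; rewrite ?lerDr.
have ub : (1 + T / (1 + g)) `^ (- a1) <= b `^ (- a1) * (1 + T / g) `^ (- a1).
  have u0 : 0 < 1 + T / g by rewrite addr_gt0 ?divr_gt0.
  rewrite -powRM ?(ltW b0) ?(ltW u0)//; apply: ge0_powRN_le => //; first exact: mulr_gt0.
  have bg : b <= g / (1 + g).
    by rewrite /b ler_pdivrMr// mulrAC ler_pdivlMr//; nra.
  rewrite mulrDr mulr1 lerD//; first by rewrite /b ler_pdivrMr// mul1r lerDr.
  apply: le_trans (ler_wpM2r (ltW (divr_gt0 T0 g0)) bg) _.
  by rewrite le_eqVlt; apply/orP; left; apply/eqP; field; rewrite !gt_eqF.
have -> : b `^ (- a1) * M `^ (- (r + al - (a0 + 1))) *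
    (T `^ a0 * g `^ (- (a0 + 1)) * (1 + T / g) `^ (- a1)) =
    M `^ (- (r + al - (a0 + 1))) * g `^ (- (a0 + 1)) *
    (b `^ (- a1) * (1 + T / g) `^ (- a1)) * T `^ a0 by ring.
have -> : bound r a0 a1 T g * g `^ (- al) =
    (1 + g) `^ (- r) * g `^ (- al) * (1 + T / (1 + g)) `^ (- a1) * T `^ a0.
  by rewrite /bound; ring.
rewrite ler_wpM2r ?powR_ge0//; apply: ler_pM; rewrite ?mulr_ge0 ?powR_ge0//.
by apply: le_trans gpow; rewrite ler_wpM2r ?powR_ge0.
Qed.
End scalar_bounds.

Theorem lemma3 (R : realType) (n r1 r2 : nat)
    (Xt : 'M[R]_(n, r1)) (Xg : 'M[R]_(n, r2)) (Sigma : 'M[R]_n)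
    (Omega : 'M[R]_r1) (nu0 s0 nu1 s1 : R) (p : R -> R) (s2 : R)
    (r1_ge1 : (1 <= r1)%N) (n_gt : (r1 + r2 < n)%N)
    (Sigma_pd : posdefmx Sigma)
    (X_rank : \rank (row_mx Xt Xg) = (r1 + r2)%N)
    (X_orth : Xt^T *m invmx Sigma *m Xg = 0)
    (Omega_pd : posdefmx Omega)
    (nu0_ge0 : 0 <= nu0) (nu1_ge0 : 0 <= nu1)
    (s0_gt0 : 0 < s0) (s1_gt0 : 0 < s1)
    (p_density : density_pos p)
    (s2_gt0 : 0 < s2)
    (nu01 : nu0 < nu1) :
  (forall M K alpha : R, 0 < M -> 0 < K -> 1 < alpha ->
     (forall g : R, M <= g -> K * g `^ (- alpha) <= p g) ->
     alpha < (n%:R - r1%:R - r2%:R + nu0) / 2 + 1 ->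
     info_consistent Xt Xg Sigma s2 (BF Xt Xg Sigma Omega nu0 s0 nu1 s1 p))
  /\
  (forall M' K' alpha : R, 0 < M' -> 0 < K' -> 1 < alpha ->
     (forall g : R, M' <= g -> p g <= K' * g `^ (- alpha)) ->
     (n%:R - r1%:R - r2%:R + nu0) / 2 + 1 <= alpha ->
     info_inconsistent Xt Xg Sigma s2 (BF Xt Xg Sigma Omega nu0 s0 nu1 s1 p)).
Proof.
have info_pd := posdef_info _ _ _ Sigma_pd X_rank.
have r2_lt : (r2 < n)%N by exact: leq_ltn_trans (leq_addl _ _) n_gt.
have [mp p0 p1] := p_density.
set a0 := half_df n r2 nu0; set a1 := half_df n r2 nu1.
have a0_gt0 : 0 < a0 by exact: half_df_gt0.
have a1_gt0 : 0 < a1 by exact: half_df_gt0.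
have a01 : a0 < a1 by rewrite /a0 /a1 /half_df ltr_pM2r ?invr_gt0// ltrD2r ltrD2l.
have -> : (n%:R - r1%:R - r2%:R + nu0) / 2 + 1 = a0 - r1%:R / 2 + 1.
  by rewrite /a0 /half_df; ring.
split=> M K al M0 K0 al1.
- move=> pK al_lt [y [ys yoo] [b yb]].
  have [E E0 HE] := BF_given_ge _ Xg _ _ _ _ _ _ _ info_pd Omega_pd r2_lt
    nu0_ge0 nu1_ge0 s0_gt0 s1_gt0 s2_gt0.
  pose ex := a0 - r1%:R / 2 - al + 1.
  have ex0 : 0 < ex by rewrite /ex; lra.
  pose F := E * (K * 2 `^ (- al)).
  have F0 : 0 < F by rewrite !mulr_gt0 ?powR_gt0.
  (* Beyond the second bound, F * tau `^ ex is at least `|b|. *)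
  pose tau0 := Num.max (Num.max 1 M) ((`|b| / F) `^ ex^-1).
  have [i] : exists i, tau0 <= qform 1%:M (gls Xt Sigma (y i)).
    move/cvgryPge : yoo => /(_ (Num.sqrt tau0))[i _ /(_ i (leqnn i))] /= H.
    exists i; move: H; rewrite enormE ler_sqrt//.
    by apply: posdef_qform_ge0; exact: posdef1.
  set tau := qform _ _; rewrite !ge_max => /andP[/andP[tau1 Mtau] btau].
  have tau_gt0 : 0 < tau := lt_le_trans ltr01 tau1.
  have := yb i; rewrite ltNge => /negP; apply.
  pose c := E * tau `^ (a0 - r1%:R / 2) * (K * (2 * tau) `^ (- al)).
  have c0 : 0 <= c by rewrite !mulr_ge0 ?powR_ge0 ?(ltW E0) ?(ltW K0).
  pose J : set R := `[tau, 2 * tau]%classic.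
  (* The conditional Bayes factor times p is at least c on J, of length tau. *)
  apply: (@le_trans _ _ (c%:E * lebesgue_measure J)%E); last first.
    apply: integral_ge_cst => //.
    + exact: measurable_itv.
    + by move=> g; rewrite /J/= !in_itv/= andbT => /andP[/(lt_le_trans tau_gt0)].
    + move=> g; rewrite /= in_itv/= andbT => g0.
      rewrite lee_fin mulr_ge0 ?p0//.
      by apply: BF_given_ge0.
    + move=> g; rewrite /J/= in_itv/= => tg; have /andP[taug gtau] := tg.
      have g0 : 0 < g := lt_le_trans tau_gt0 taug.
      rewrite lee_fin; apply: ler_pM; rewrite ?mulr_ge0 ?powR_ge0 ?(ltW E0) ?(ltW K0)//.
        exact: HE.
      apply: le_trans (pK g (le_trans Mtau taug)).
      rewrite ler_pM2l//; apply: ge0_powRN_le => //.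
      exact: le_trans ler01 (ltW al1).
  rewrite /J lebesgue_measure_itv/= lte_fin ltr_pMl// ltr1n -EFinB -EFinM lee_fin.
  have -> : c * (2 * tau - tau) = F * tau `^ ex.
    have -> : tau `^ ex = tau `^ (a0 - r1%:R / 2) * tau `^ (- al) * tau.
      by rewrite -{4}[tau]powRr1 ?(ltW tau_gt0)// -!gt0_powRD.
    by rewrite /c /F powRM ?(ltW tau_gt0)//; ring.
  have bF : `|b| / F <= tau `^ ex.
    have -> : `|b| / F = ((`|b| / F) `^ ex^-1) `^ ex.
      by rewrite -powRrM mulVf ?gt_eqF// powRr1// divr_ge0 ?(ltW F0).
    by apply: ge0_ler_powR btau; rewrite ?nnegrE ?powR_ge0 ?(ltW ex0) ?(ltW tau_gt0).
  by apply: le_trans (ler_norm b) _; rewrite mulrC -ler_pdivrMr.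
- move=> pK al_ge.
  have [w [wt wg ws]] := exists_residual Xt Xg _ Sigma_pd _ n_gt s2_gt0.
  pose e : 'cV[R]_r1 := const_mx 1.
  have e0 : e != 0.
    apply/eqP => /colP/(_ (Ordinal r1_ge1))/eqP; rewrite !mxE oner_eq0//.
  have uI := posdef_unit _ info_pd.
  pose y (i : nat) := Xt *m (i.+1%:R *: e) + w.
  have ys i : resid_ss Xt Xg Sigma (y i) = s2 by rewrite resid_ss_data.
  have yg i : gls Xt Sigma (y i) = i.+1%:R *: e by rewrite gls_data.
  exists y.
    split=> //; under eq_fun do rewrite yg enormE qform_scale.
    apply/cvgryPge => A.
    have q0 : 0 < qform 1%:M e by apply: (proj2 (@posdef1 R r1)).
    have sq0 : 0 < Num.sqrt (qform 1%:M e) by rewrite sqrtr_gt0.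
    exists (Num.bound (`|A| / Num.sqrt (qform 1%:M e))) => // i /= Ni.
    rewrite sqrtrM ?sqr_ge0// sqrtr_sqr ger0_norm// -ler_pdivrMr//.
    apply: (@le_trans _ _ (`|A| / Num.sqrt (qform 1%:M e))).
      by rewrite ler_pM2r ?invr_gt0// ler_norm.
    have A0 : 0 <= `|A| / Num.sqrt (qform 1%:M e) by rewrite divr_ge0 ?(ltW sq0).
    by apply/ltW/(lt_le_trans (archi_boundP A0)); rewrite ler_nat leqW.
  have [E E0 HE] := BF_given_le _ Xg _ _ _ _ _ _ _ info_pd Omega_pd r2_lt
    nu0_ge0 nu1_ge0 s0_gt0 s1_gt0 s2_gt0 _ e0.
  pose d := Num.min a0 (a1 - a0).
  have d0 : 0 < d by rewrite lt_min a0_gt0 subr_gt0.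
  have r10 : 0 <= r1%:R / 2 :> R by rewrite divr_ge0.
  have [|||B B0 HB] := @bound_large_g R (r1%:R / 2) a0 a1 al d M M0 r10 (ltW a1_gt0) (ltW d0).
  + by rewrite ge_min lexx.
  + by rewrite ge_min lexx orbT.
  + lra.
  pose A := E * (1 + M) `^ a1.
  have A0 : 0 <= A by rewrite mulr_ge0 ?powR_ge0 ?(ltW E0).
  pose B' := E * K * B.
  have B'0 : 0 <= B' by rewrite !mulr_ge0 ?(ltW E0) ?(ltW K0) ?(ltW B0).
  (* A bounds the part g <= M through the unit mass of p, and B' / d the part
     g > M; the added 1 makes the final inequality strict. *)
  exists (A + B' * d^-1 + 1) => i.
  pose T : R := i.+1%:R ^+ 2.
  have T1 : 1 <= T by rewrite exprn_ege1// ler1n.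
  have T0 : 0 < T := lt_le_trans ltr01 T1.
  apply: (@le_lt_trans _ _ (A + B' * d^-1)%:E); last by rewrite lte_fin ltrDl.
  apply: (@le_trans _ _ (\int[lebesgue_measure]_(g in `]0%R, +oo[)
      (A%:E * (p g)%:E + B'%:E * (loglogistic T d g)%:E))%E).
    apply: le_integral_nonneg => g; rewrite /= in_itv/= andbT => g0.
      by rewrite lee_fin mulr_ge0 ?p0//; exact: BF_given_ge0.
    rewrite -!EFinM -EFinD lee_fin.
    have := HE (y i) i.+1%:R g (ys i) (yg i).
    rewrite ler1n => /(_ isT g0) => Hbf.
    have [gM|gM] := leP g M.
      apply: ler_wpDr; first exact: mulr_ge0 B'0 (loglogistic_ge0 _ _ _).
      rewrite ler_wpM2r ?p0//; apply: le_trans Hbf _.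
      rewrite ler_pM2l//; apply: bound_small_g => //; exact: ltW.
    apply: ler_wpDl; first exact: mulr_ge0 A0 (p0 _ g0).
    apply: le_trans (ler_wpM2r (p0 _ g0) Hbf) _.
    apply: le_trans (ler_wpM2l _ (pK g (ltW gM))) _.
      by rewrite !mulr_ge0 ?powR_ge0 ?(ltW E0).
    rewrite mulrACA -/T.
    have -> : B' * loglogistic T d g = E * K * (B * loglogistic T d g) by rewrite /B' mulrA.
    rewrite ler_pM2l ?mulr_gt0//.
    by apply: HB => //; exact: ltW.
  have mpE : measurable_fun (`]0%R, +oo[ : set R) (fun g => (p g)%:E).
    by apply/measurable_EFinP.
  have mkE : measurable_fun (`]0%R, +oo[ : set R) (fun g => (loglogistic T d g)%:E).
    by apply/measurable_EFinP; exact: measurable_loglogistic.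
  have pE0 (g : R) : `]0, +oo[%classic g -> (0 <= (p g)%:E)%E.
    by rewrite /= in_itv/= andbT lee_fin; exact: p0.
  have kE0 (g : R) : `]0, +oo[%classic g -> (0 <= (loglogistic T d g)%:E)%E.
    by move=> _; rewrite lee_fin loglogistic_ge0.
  rewrite ge0_integralD//.
  - rewrite !ge0_integralZl// p1 mule1 EFinD EFinM leeD2l//.
    rewrite [(B' / d)%:E]EFinM; apply: lee_wpmul2l; rewrite ?lee_fin//.
    exact: integral_loglogistic_le.
  - by move=> g /pE0; apply: mule_ge0; rewrite lee_fin.
  - exact: measurable_funeM.
  - by move=> g /kE0; apply: mule_ge0; rewrite lee_fin.
  - exact: measurable_funeM.
Qed.
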